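(* Let $\gamma>0$, $\delta\in(0,1)$ and $\theta=\frac{9}{2\ln\frac{2}{\delta}}$. Define $$\underline{\boldsymbol{\mu}}=\frac{\gamma}{\boldsymbol{n}}+\frac{3}{4+\boldsymbol{n}\theta}\left[1-\frac{2\gamma}{\boldsymbol{n}}-\sqrt{1+\theta\gamma\left(1-\frac{\gamma}{\boldsymbol{n}}\right)}\right],$$ and $$\overline{\boldsymbol{\mu}}=\begin{cases}\dfrac{\gamma}{\boldsymbol{n}-1}+\dfrac{3}{4+(\boldsymbol{n}-1)\theta}\left[1-\dfrac{2\gamma}{\boldsymbol{n}-1}+\sqrt{1+\theta\gamma\left(1-\dfrac{\gamma}{\boldsymbol{n}-1}\right)}\right] & \text{for } \boldsymbol{n}>\gamma+1,\\[2mm] 1 & \text{for } \boldsymbol{n}\le\gamma+1.\end{cases}$$ Then $$\Pr\{\underline{\boldsymbol{\mu}}<\mu<\overline{\boldsymbol{\mu}}\}\ge 1-\delta.$$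
   Context: $X$ is a random variable with values in $[0,1]$ on a probability space $(\Omega,\mathscr{F},\Pr)$, with mean $\mathbb{E}[X]=\mu\in(0,1)$, and $X_1,X_2,\ldots$ are i.i.d. samples of $X$. Inverse sampling with threshold $\gamma>0$: sampling continues until the sample sum is no less than $\gamma$, and $\boldsymbol{n}$ is the (random) sample size at stopping, i.e. the smallest positive integer $n$ such that $\sum_{i=1}^{n}X_i\ge\gamma$ (it is finite almost surely, and $\boldsymbol{n}\ge\gamma$). *)

(* Defs.v *)
From mathcomp Require Import all_boot all_order all_algebra.
From mathcomp Require Import all_classical all_reals all_analysis.

Set Implicit Arguments.
Unset Strict Implicit.
Unset Printing Implicit Defensive.

Import Order.TTheory GRing.Theory Num.Theory.
Import numFieldNormedType.Exports.

Local Open Scope classical_set_scope.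
Local Open Scope ring_scope.

Section iid.
Context d (T : measurableType d) (R : realType) (P : probability T R).

Definition mutually_independent (Xs : nat -> {RV P >-> R}) : Prop :=
  forall (J : seq nat) (B : nat -> set R),
    uniq J -> (forall i, measurable (B i)) ->
    P (\bigcap_(i in [set` J]) (Xs i @^-1` B i)) =
    (\prod_(i <- J) P (Xs i @^-1` B i))%E.

(* The laws are compared on measurable sets only: the values of a measure on
   non-measurable sets carry no meaning. *)
Definition same_law (X Y : {RV P >-> R}) : Prop :=
  forall B : set R, measurable B -> distribution P X B = distribution P Y B.

Definition iid_samples (X : {RV P >-> R}) (Xs : nat -> {RV P >-> R}) : Prop :=
  mutually_independent Xs /\ forall i, same_law (Xs i) X.

End iid.

Section inverse_sampling.
Context (R : realType).

(* Samples are numbered from 0, so the sum of the first n samples is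
   x 0 + ... + x (n - 1). *)
Definition is_sample_size (gamma : R) (x : nat -> R) (n : nat) : Prop :=
  [/\ (0 < n)%N,
      gamma <= \sum_(i < n) x i &
      forall m : nat, (0 < m)%N -> gamma <= \sum_(i < m) x i -> (n <= m)%N].

(* Default value 0, never a genuine sample size, when the sums stay below
   gamma forever. *)
Definition sample_size (gamma : R) (x : nat -> R) : nat :=
  xget 0%N [set n | is_sample_size gamma x n].

Definition theta (delta : R) : R := 9 / (2 * ln (2 / delta)).

Definition lower_limit (gamma delta : R) (n : nat) : R :=
  gamma / n%:R +
  3 / (4 + n%:R * theta delta) *
    (1 - 2 * gamma / n%:R
     - Num.sqrt (1 + theta delta * gamma * (1 - gamma / n%:R))).

(* The subtraction n%:R - 1 is in R, not the truncated one of nat. *)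
Definition upper_limit (gamma delta : R) (n : nat) : R :=
  if gamma + 1 < n%:R then
    gamma / (n%:R - 1) +
    3 / (4 + (n%:R - 1) * theta delta) *
      (1 - 2 * gamma / (n%:R - 1)
       + Num.sqrt (1 + theta delta * gamma * (1 - gamma / (n%:R - 1))))
  else 1.

End inverse_sampling.

(* Main.v *)
Require Import Defs.
From mathcomp Require Import all_boot all_order all_algebra.
From mathcomp Require Import all_classical all_reals all_analysis.
From mathcomp Require Import measurable_realfun.
From mathcomp Require Import ring lra.

Set Implicit Arguments.
Unset Strict Implicit.
Unset Printing Implicit Defensive.

Import Order.TTheory GRing.Theory Num.Theory.
Import numFieldNormedType.Exports.

Local Open Scope classical_set_scope.
Local Open Scope ring_scope.

(** Write z = gamma / k. Up to the choice of root, the two limits are the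
    solutions in mu of k * (z - mu)^2 / (2 a (1 - a)) = ln (2 / delta), with
    a = (2 mu + z) / 3, taken at k = n and k = n - 1 respectively. The left-hand
    side is the exponent of Massart's inequality, which bounds the probability
    that k samples have a mean at least z (if mu <= z) or at most z (if
    z <= mu). If the lower limit fails at n, let m be the largest sample size at
    which it can fail: n <= m forces the first m samples to sum to at least
    gamma, an event of probability at most delta / 2. If the upper limit fails
    at n, let m be the smallest such sample size: the first m - 1 samples have
    not reached gamma, again an event of probability at most delta / 2.
    Massart's exponent is bounded by the relative entropy through
    y ln (y / x) - y + x >= 3 (y - x)^2 / (2 (2 x + y)), applied to (mu, z) and
    to (1 - mu, 1 - z). *)

(** * Bounds on the logarithm and on the relative entropy *)

Section real_inequalities.
Context {R : realType}.
Implicit Types (x y z u mu t : R).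

(** Up to the constant 5/2, the function is [ln] minus the rational bound of [pade_le_ln] in partial
    fractions; its derivative has the sign of [u - 1]. *)
Let is_derive_ln_sub_pade u : 0 < u ->
  is_derive u 1 (fun v : R => ln v + v^-1 / 4 + (v + 2)^-1 * (27 / 4))
    ((u - 1) ^+ 3 / (u ^+ 2 * (u + 2) ^+ 2)).
Proof.
move=> u0; have uN0 : u != 0 by lra.
have u2 : u + 2 != 0 by lra.
have dln := is_derive1_ln u0.
have du2 : is_derive u 1 (fun v : R => v + 2) 1.
  by apply: is_derive_eq; rewrite addr0.
have dV := @is_deriveV R (fun v : R => v) u 1 1 uN0 _.
have dV2 := @is_deriveV R (fun v : R => v + 2) u 1 1 u2 du2.
apply: is_derive_eq.
by rewrite /GRing.scale /=; field; rewrite uN0 u2.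
Qed.

(** The difference of the two sides decreases before 1 and increases after it, and vanishes at 1;
    the mean value theorem is applied on each side. *)
Lemma pade_le_ln u : 0 < u ->
  (u - 1) * (5 * u + 1) / (2 * u * (u + 2)) <= ln u.
Proof.
move=> u0.
pose f := fun v : R => ln v + v^-1 / 4 + (v + 2)^-1 * (27 / 4).
have cf a b : 0 < a -> {within `[a, b], continuous f}.
  move=> a0; apply: derivable_within_continuous => x.
  rewrite in_itv/= => /andP[ax _].
  by have /is_derive_ln_sub_pade[] : 0 < x by lra.
have fE : f 1 = 5 / 2 by rewrite /f ln1; field.
suff: f 1 <= f u.
  rewrite fE -subr_ge0 => fu; rewrite -subr_ge0; apply: le_trans fu _.
  rewrite le_eqVlt; apply/orP; left; apply/eqP; rewrite /f.
  by field; apply/andP; split; lra.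
pose df (v : R) : R := (v - 1) ^+ 3 / (v ^+ 2 * (v + 2) ^+ 2).
have dfE (c : R) : df c = (c - 1) * ((c - 1) ^+ 2 / (c ^+ 2 * (c + 2) ^+ 2)).
  by rewrite /df exprS mulrA.
have r0 (c : R) : 0 <= (c - 1) ^+ 2 / (c ^+ 2 * (c + 2) ^+ 2).
  by apply: divr_ge0; [exact: sqr_ge0|apply: mulr_ge0; exact: sqr_ge0].
have [u1|u1|->//] := ltgtP u 1; rewrite -subr_ge0.
- have [|c + fuE] := @MVT _ f df u 1 u1 _ (cf _ _ u0).
    move=> x; rewrite in_itv/= => /andP[ux _].
    by apply: is_derive_ln_sub_pade; lra.
  rewrite in_itv/= => /andP[uc c1].
  rewrite -opprB fuE dfE -mulNr -mulNr.
  by apply: mulr_ge0; [apply: mulr_ge0; [lra|exact: r0]|lra].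
- have [|c + ->] := @MVT _ f df 1 u u1 _ (cf _ _ ltr01).
    move=> x; rewrite in_itv/= => /andP[ux _].
    by apply: is_derive_ln_sub_pade; lra.
  rewrite in_itv/= => /andP[c1 _].
  rewrite dfE.
  by apply: mulr_ge0; [apply: mulr_ge0; [lra|exact: r0]|lra].
Qed.

(** This is [pade_le_ln] at [y / x], multiplied by [y]: subtracting [y - x] from the rational bound
    leaves exactly the left-hand side. *)
Lemma bennett_le x y : 0 < x -> 0 < y ->
  3 * (y - x) ^+ 2 / (2 * (2 * x + y)) <= y * ln (y / x) - y + x.
Proof.
move=> x0 y0; have /pade_le_ln : 0 < y / x by rewrite divr_gt0.
rewrite -(ler_pM2l y0) => h.
rewrite -subr_ge0; apply: le_trans (_ : 0 <= y * ln (y / x) - _) _.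
  by rewrite subr_ge0; exact: h.
rewrite le_eqVlt; apply/orP; left; apply/eqP.
by field; rewrite !gt_eqF//=; lra.
Qed.

(** The exponent for one sample: Gaussian in shape, with the Bernoulli variance taken at [a], a
    third of the way from [mu] to [z]. *)
Definition massart_exponent z mu : R :=
  let a := (2 * mu + z) / 3 in (z - mu) ^+ 2 / (2 * a * (1 - a)).

(** Since 1/(a(1-a)) = 1/a + 1/(1-a), the exponent is the sum of the two [bennett_le] bounds, whose
    linear terms cancel. *)
Lemma massart_le z mu : 0 < z < 1 -> 0 < mu < 1 ->
  massart_exponent z mu <=
  z * ln (z / mu) + (1 - z) * ln ((1 - z) / (1 - mu)).
Proof.
move=> /andP[z0 z1] /andP[m0 m1].
have h1 := bennett_le m0 z0.
have h2 : 3 * ((1 - z) - (1 - mu)) ^+ 2 / (2 * (2 * (1 - mu) + (1 - z))) <=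
    (1 - z) * ln ((1 - z) / (1 - mu)) - (1 - z) + (1 - mu).
  by apply: bennett_le; lra.
have -> : massart_exponent z mu =
  3 * (z - mu) ^+ 2 / (2 * (2 * mu + z)) +
  3 * ((1 - z) - (1 - mu)) ^+ 2 / (2 * (2 * (1 - mu) + (1 - z))).
  by rewrite /massart_exponent; field; repeat (apply/andP; split); lra.
by lra.
Qed.

(** The relative entropy at z = 1 is [- ln mu]. Here [bennett_le] leaves a linear term [1 - mu], of
    which the exponent uses only 3/4; hence strictness. *)
Lemma massart_exponent1_lt mu : 0 < mu < 1 -> massart_exponent 1 mu < - ln mu.
Proof.
move=> /andP[m0 m1]; have := bennett_le m0 (@ltr01 R).
rewrite div1r lnV ?posrE// mul1r => h.
suff : massart_exponent 1 mu =
  3 * (1 - mu) ^+ 2 / (2 * (2 * mu + 1)) + 3 / 4 * (1 - mu) by lra.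
by rewrite /massart_exponent; field; repeat (apply/andP; split); lra.
Qed.

Lemma massart_exponent_ge0 z mu : 0 < z <= 1 -> 0 < mu < 1 ->
  0 <= massart_exponent z mu.
Proof.
move=> z01 mu01; rewrite /massart_exponent divr_ge0 ?sqr_ge0//.
by rewrite !mulr_ge0//; lra.
Qed.

(** The left-hand side is the Chernoff factor of a Bernoulli variable of mean [mu]. The sign
    condition on [t] lets one statement serve both tails. *)
Lemma chernoff_massart z mu : 0 < z <= 1 -> 0 < mu < 1 ->
  exists2 t, 0 <= (z - mu) * t &
    expR (- (t * z)) * (1 + mu * (expR t - 1)) <=
    expR (- massart_exponent z mu).
Proof.
move=> /andP[z0]; rewrite le_eqVlt => /predU1P[->|z1] mu01.
  have /andP[m0 m1] := mu01.
  (* At z = 1 the optimal t is infinite, but the strict inequality leaves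
     room for a finite one. *)
  set e := massart_exponent 1 mu.
  have mue : 0 < expR (- e) - mu.
    by rewrite subr_gt0 -{1}[mu]lnK ?posrE// ltr_expR ltrNr
      massart_exponent1_lt.
  have e1 : expR (- e) <= 1.
    by rewrite expR_le1 oppr_le0 massart_exponent_ge0// ltr01 lexx.
  have y0 : 0 < (1 - mu) / (expR (- e) - mu) by rewrite divr_gt0//; lra.
  (* This [t] solves exp(-t)(1 - mu) + mu = exp(-e), so the bound holds with equality. *)
  exists (ln ((1 - mu) / (expR (- e) - mu))).
    rewrite mulr_ge0//; first lra.
    by rewrite ln_ge0// ler_pdivlMr// mul1r; lra.
  rewrite mulr1 expRN lnK ?posrE//.
  rewrite le_eqVlt; apply/orP; left; apply/eqP.
  by field; repeat (apply/andP; split); lra.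
have /andP[m0 m1] := mu01.
have z'0 : 0 < 1 - z by lra.
have m'0 : 0 < 1 - mu by lra.
have zm0 : 0 < z / mu by rewrite divr_gt0.
have zm'0 : 0 < (1 - z) / (1 - mu) by rewrite divr_gt0.
(* The minimizer of the Chernoff factor, the log odds ratio; the minimum is exp of minus the
   relative entropy. *)
exists (ln (z / mu) - ln ((1 - z) / (1 - mu))).
  have [mz|zm] := leP mu z.
    rewrite mulr_ge0 ?subr_ge0// ler_ln ?posrE//.
    by rewrite ler_pdivlMr// mulrAC ler_pdivrMr//; nra.
  rewrite mulr_le0 ?subr_le0 ?(ltW zm)// ler_ln ?posrE//.
  by rewrite ler_pdivlMr// mulrAC ler_pdivrMr//; nra.
have -> : 1 + mu * (expR (ln (z / mu) - ln ((1 - z) / (1 - mu))) - 1) =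
    expR (- ln ((1 - z) / (1 - mu))).
  by rewrite expRD expRN !lnK ?posrE//; field; rewrite !gt_eqF.
rewrite -expRD ler_expR.
have := massart_le (introT andP (conj z0 z1)) mu01; lra.
Qed.
End real_inequalities.

(** * From the confidence limits to Massart's exponent *)

Section confidence_limits.
Context {R : realType}.
Implicit Types (k th z mu gamma delta : R) (n : nat).

(** For 0 < z <= 1, [s >= 1 >= |1 - 2z|] fixes the sign of 1 - 2z - s and of 1 - 2z + s, hence the
    side of [z] on which each limit lies. *)
Let radicand_sqrt gamma th z : 0 < gamma -> 0 < th -> z <= 1 ->
  let s := Num.sqrt (1 + th * gamma * (1 - z)) in
  1 <= s /\ s ^+ 2 = 1 + th * gamma * (1 - z).
Proof.
move=> g0 th0 z1 s.
have r1 : 1 <= 1 + th * gamma * (1 - z).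
  by rewrite lerDl mulr_ge0 ?subr_ge0// mulr_ge0// ltW.
split; last by rewrite sqr_sqrtr// (le_trans _ r1).
by rewrite -[X in X <= _]sqrtr1 ler_sqrt// (le_trans _ r1).
Qed.

(* The two limits are the roots, as quadratic equations in mu, of
   k * massart_exponent z mu = 9 / (2 * th). *)
Let massart_exponent_outside_roots gamma k th z mu : 0 < k -> 0 < th ->
  0 < z <= 1 -> 0 < mu < 1 -> gamma = k * z ->
  9 * (1 + th * gamma * (1 - z)) <=
    ((4 + k * th) * (mu - z) - 3 * (1 - 2 * z)) ^+ 2 ->
  9 / (2 * th) <= k * massart_exponent z mu.
Proof.
move=> k0 th0 /andP[z0 z1] /andP[m0 m1] -> h.
have A0 : 0 < 4 + k * th by rewrite addr_gt0// mulr_gt0.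
(* After expansion the constant terms combine to -9(4 + k th)z(1 - z), so the positive factor 4 + k
   th divides out. *)
have {}h : 0 <= (4 + k * th) * (mu - z) ^+ 2
    - 6 * (1 - 2 * z) * (mu - z) - 9 * z * (1 - z).
  by rewrite -(pmulr_rge0 _ A0); lra.
rewrite /massart_exponent ler_pdivrMr ?mulr_gt0//.
rewrite [X in _ <= X](_ : _ = (9 * k * th * (mu - z) ^+ 2) /
    ((2 * mu + z) * (3 - 2 * mu - z))); last first.
  by field; repeat (apply/andP; split); lra.
by rewrite ler_pdivlMr ?mulr_gt0//; lra.
Qed.

Lemma theta_gt0 delta : 0 < delta < 1 -> 0 < theta delta.
Proof.
move=> /andP[d0 d1]; rewrite /theta divr_gt0// mulr_gt0// ln_gt0//.
by rewrite ltr_pdivlMr//; lra.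
Qed.

Let theta_inv delta : 0 < delta < 1 -> 9 / (2 * theta delta) = ln (2 / delta).
Proof.
move=> d01; have := theta_gt0 d01; rewrite /theta => t0.
have L0 : ln (2 / delta) != 0.
  by apply: contraTneq t0 => ->; rewrite mulr0 invr0 mulr0 ltxx.
by field.
Qed.

Lemma lower_limit_ge gamma delta mu n : 0 < gamma -> 0 < delta < 1 ->
  0 < mu < 1 -> gamma <= n%:R -> mu <= lower_limit gamma delta n ->
  mu <= gamma / n%:R /\
  ln (2 / delta) <= n%:R * massart_exponent (gamma / n%:R) mu.
Proof.
move=> g0 d01 mu01 gn; rewrite /lower_limit -(mulrA 2 gamma).
have th0 := theta_gt0 d01.
have n0 : 0 < n%:R :> R by exact: lt_le_trans gn.
have z01 : 0 < gamma / n%:R <= 1 by rewrite divr_gt0//= ler_pdivrMr// mul1r.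
have gE : gamma = n%:R * (gamma / n%:R) by rewrite mulrC divfK ?gt_eqF.
set z := gamma / n%:R in z01 gE *.
have [] := radicand_sqrt g0 th0 (proj2 (andP z01)).
set s := Num.sqrt _ => s1 s2 muz.
have A0 : 0 < 4 + n%:R * theta delta by rewrite addr_gt0// mulr_gt0.
have {}muz : (4 + n%:R * theta delta) * (mu - z) <= 3 * (1 - 2 * z - s).
  by rewrite mulrC -ler_pdivlMr// mulrAC lerBlDl.
split.
  rewrite -subr_le0 -(pmulr_rle0 _ A0) (le_trans muz)//.
  by rewrite pmulr_rle0//; lra.
rewrite -theta_inv//.
apply: (massart_exponent_outside_roots n0 th0 z01 mu01 gE).
(* By [muz], the quantity to be squared is at most -3s <= 0, so its square is at least 9s^2. *)
by rewrite -s2; nra.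
Qed.

(** The mirror argument at the larger root, with n - 1 for n; [gamma + 1 < n] keeps gamma / (n - 1)
    below 1. *)
Lemma upper_limit_le gamma delta mu n : 0 < gamma -> 0 < delta < 1 ->
  0 < mu < 1 -> gamma + 1 < n%:R -> upper_limit gamma delta n <= mu ->
  gamma / (n%:R - 1) <= mu /\
  ln (2 / delta) <= (n%:R - 1) * massart_exponent (gamma / (n%:R - 1)) mu.
Proof.
move=> g0 d01 mu01 gn; rewrite /upper_limit gn -(mulrA 2 gamma).
have th0 := theta_gt0 d01.
have n0 : 0 < n%:R - 1 :> R by lra.
have z01 : 0 < gamma / (n%:R - 1) <= 1.
  by rewrite divr_gt0//= ler_pdivrMr// mul1r; lra.
have gE : gamma = (n%:R - 1) * (gamma / (n%:R - 1)).
  by rewrite mulrC divfK ?gt_eqF.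
set z := gamma / (n%:R - 1) in z01 gE *.
have [] := radicand_sqrt g0 th0 (proj2 (andP z01)).
set s := Num.sqrt _ => s1 s2 muz.
have A0 : 0 < 4 + (n%:R - 1) * theta delta by rewrite addr_gt0// mulr_gt0.
have {}muz : 3 * (1 - 2 * z + s) <= (4 + (n%:R - 1) * theta delta) * (mu - z).
  by rewrite [X in _ <= X]mulrC -ler_pdivrMr// mulrAC lerBrDl.
split.
  rewrite -subr_ge0 -(pmulr_rge0 _ A0) (le_trans _ muz)//.
  by rewrite pmulr_rge0//; lra.
rewrite -theta_inv//.
apply: (massart_exponent_outside_roots n0 th0 z01 mu01 gE).
by rewrite -s2; nra.
Qed.

End confidence_limits.

(** * Integrals of products with a function of a random element *)

Section integral_of_product.
Local Open Scope ereal_scope.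
Context d d' (T : measurableType d) (T' : measurableType d') (R : realType).
Variable mu : {measure set T -> \bar R}.
Variables (Y : T -> T') (mY : measurable_fun setT Y).

Import HBNNSimple.

Let ge0_integral_mul_nnsfun (g : T -> R) (h : {nnsfun T' >-> R}) :
  measurable_fun setT g -> (forall x, 0 <= g x)%R ->
  \int[mu]_x (g x * h (Y x))%:E =
  \sum_(k \in range h)
    k%:E * \int[mu]_(x in Y @^-1` (h @^-1` [set k])) (g x)%:E.
Proof.
move=> mg g0.
have mB k : measurable (Y @^-1` (h @^-1` [set k])).
  by rewrite -[X in measurable X]setTI; exact: mY.
pose gB k x : R := (g x * \1_(Y @^-1` (h @^-1` [set k])) x)%R.
have mi k : measurable_fun setT (EFin \o gB k).
  by apply/measurable_EFinP; exact: measurable_funM.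
transitivity (\int[mu]_x \sum_(k \in range h)
    (k * gB k x)%:E).
  apply: eq_integral => x _; rewrite fsumEFin//; congr EFin.
  rewrite {1}fimfunE mulr_fsumr; apply: eq_fsbigr => k _.
  by rewrite mulrCA.
rewrite ge0_integral_fsum//; last 2 first.
- by move=> k; exact: (measurable_funeM k%:E (mi k)).
- move=> k x _; rewrite lee_fin mulrCA mulr_ge0// -lee_fin EFinM.
  exact: (nnfun_muleindic_ge0 h k (Y x)).
apply: eq_fsbigr => k; rewrite inE => -[y _ hy].
have k0 : (0 <= k)%R by rewrite -hy.
rewrite (eq_integral (fun x => k%:E * (gB k x)%:E)) => [|x _]; last first.
  by rewrite EFinM.
rewrite (ge0_integralZl_EFin _ _ _ (mi k))//; last first.
  by move=> x _; rewrite lee_fin mulr_ge0.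
by rewrite [in RHS]integral_mkcond epatch_indic.
Qed.

(** Agreement on the events of [Y] gives the claim for simple [f] through their level sets, then for
    all [f] by monotone convergence. *)
Lemma eq_ge0_integral_mul_comp (g1 g2 : T -> R) (f : T' -> R) :
  measurable_fun setT g1 -> (forall x, 0 <= g1 x)%R ->
  measurable_fun setT g2 -> (forall x, 0 <= g2 x)%R ->
  measurable_fun setT f -> (forall y, 0 <= f y)%R ->
  (forall B, measurable B ->
    \int[mu]_(x in Y @^-1` B) (g1 x)%:E =
    \int[mu]_(x in Y @^-1` B) (g2 x)%:E) ->
  \int[mu]_x (g1 x * f (Y x))%:E = \int[mu]_x (g2 x * f (Y x))%:E.
Proof.
move=> mg1 g10 mg2 g20 mf f0 g12.
have mEf : measurable_fun setT (EFin \o f) by exact/measurable_EFinP.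
pose f_ := nnsfun_approx measurableT mEf.
have lim_f (g : T -> R) : measurable_fun setT g -> (forall x, 0 <= g x)%R ->
    \int[mu]_x (g x * f (Y x))%:E =
    limn (fun n => \int[mu]_x (g x * f_ n (Y x))%:E).
  move=> mg g0; rewrite -monotone_convergence//.
  - apply: eq_integral => x _; apply/esym/cvg_lim => //.
    under eq_fun do rewrite EFinM.
    rewrite EFinM; apply: cvgeZl => //.
    by apply: (cvg_nnsfun_approx measurableT mEf) => // y _; rewrite lee_fin.
  - move=> n; apply/measurable_EFinP/measurable_funM => //.
    exact: measurableT_comp.
  - by move=> n x _; rewrite lee_fin mulr_ge0.
  - move=> x _ m n mn; rewrite lee_fin ler_wpM2l//.
    exact/lefP/nd_nnsfun_approx.
rewrite !lim_f//; congr (limn _); apply/funext => n.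
rewrite !ge0_integral_mul_nnsfun//; apply: eq_fsbigr => k _.
by rewrite g12.
Qed.

End integral_of_product.

(** * Product formula for independent variables *)

Section independence.
Local Open Scope ereal_scope.
Context d (T : measurableType d) (R : realType) (P : probability T R).
Variable Xs : nat -> {RV P >-> R}.
Hypothesis Xs_indep : mutually_independent Xs.

(* Generalized by events so that the factors of the product can be turned from
   indicators into arbitrary functions one at a time. *)
Let integral_prod_setI_indep (f : nat -> R -> R) (J1 J2 : seq nat)
    (B : nat -> set R) :
  (forall i, measurable_fun setT (f i)) -> (forall i x, 0 <= f i x)%R ->
  (forall i, \int[P]_w (f i (Xs i w))%:E < +oo) ->
  uniq (J1 ++ J2) -> (forall i, measurable (B i)) ->
  \int[P]_(w in \bigcap_(i in [set` J2]) (Xs i @^-1` B i))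
    (\prod_(i <- J1) f i (Xs i w))%:E =
  \prod_(i <- J1) \int[P]_w (f i (Xs i w))%:E *
  \prod_(i <- J2) P (Xs i @^-1` B i).
Proof.
move=> mf f0 foo; elim: J1 J2 B => [|j J1 IH] J2 B.
  move=> /= uJ2 mB; rewrite big_nil mul1e.
  under eq_integral do rewrite big_nil.
  rewrite integral_cst; last first.
    by apply: bigcap_measurableType => i _; exact: measurable_funPTI.
  by rewrite mul1e; exact: Xs_indep.
move=> uJ mB.
have mA : measurable (\bigcap_(i in [set` J2]) (Xs i @^-1` B i)).
  by apply: bigcap_measurableType => i _; exact: measurable_funPTI.
set A := \bigcap_(i in _) _ in mA *.
pose g w : R := (\prod_(i <- J1) f i (Xs i w) * \1_A w)%R.
have mg : measurable_fun setT g.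
  apply: measurable_funM => //; apply: measurable_prod => i _.
  exact: measurableT_comp.
have g0 w : (0 <= g w)%R by rewrite mulr_ge0// prodr_ge0.
pose c : \bar R := \prod_(i <- J1) \int[P]_w (f i (Xs i w))%:E *
  \prod_(i <- J2) P (Xs i @^-1` B i).
have int_fin i : \int[P]_w (f i (Xs i w))%:E \is a fin_num.
  by rewrite ge0_fin_numE// integral_ge0// => w _; rewrite lee_fin.
have c_fin : c \is a fin_num.
  rewrite fin_numM// prode_fin_num// => i _.
  by rewrite fin_num_measure//; exact: measurable_funPTI.
have c0 : (0 <= fine c)%R.
  rewrite fine_ge0// mule_ge0// prode_ge0// => i _.
  by rewrite integral_ge0// => w _; rewrite lee_fin.
(* The induction hypothesis with [j] moved to the events: [B'] puts [D] at [j] and, as [j] is not in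
   [J2], leaves the other events alone. *)
have gB D : measurable D ->
    \int[P]_(w in Xs j @^-1` D) (g w)%:E = c * P (Xs j @^-1` D).
  move=> mD; pose B' i := if i == j then D else B i.
  have jJ2 : j \notin J2.
    by move: uJ; rewrite /= mem_cat negb_or => /andP[/andP[_]].
  have B'E i : i \in J2 -> B' i = B i.
    by rewrite /B'; case: eqP => // -> jJ; rewrite jJ in jJ2.
  have PB' : \prod_(i <- J2) P (Xs i @^-1` B' i) =
      \prod_(i <- J2) P (Xs i @^-1` B i).
    by apply: eq_big_seq => i iJ; rewrite B'E.
  have AB' : \big[setI/setT]_(i <- J2) (Xs i @^-1` B' i) = A.
    by rewrite /A bigcap_seq; apply: eq_big_seq => i iJ; rewrite B'E.
  have := IH (j :: J2) B'; rewrite bigcap_seq !big_cons PB' AB'.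
  have -> : B' j = D by rewrite /B' eqxx.
  rewrite [P _ * _]muleC muleA -/c => <-.
  - rewrite [LHS]integral_mkcond [RHS]integral_mkcond !epatch_indic.
    apply: eq_integral => w _ /=.
    by rewrite /g setIC indicI EFinM -muleA -EFinM.
  - by rewrite -cat1s uniq_catCA cat1s.
  - by move=> i; rewrite /B'; case: ifP.
transitivity (\int[P]_w (g w * f j (Xs j w))%:E).
  rewrite integral_mkcond epatch_indic; apply: eq_integral => w _ /=.
  by rewrite big_cons /g -EFinM; congr EFin; ring.
(* By [gB], [g] integrates over events of [Xs j] like the constant [c], which may therefore replace
   it. *)
rewrite (eq_ge0_integral_mul_comp _ mg g0 (g2 := cst (fine c)))//; last first.
  move=> D mD; rewrite gB//= (integral_cst _ _ (fine c)%:E); last first.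
    exact: measurable_funPTI.
  by rewrite fineK.
under eq_integral do rewrite EFinM.
rewrite ge0_integralZl_EFin//; last 2 first.
- by move=> w _; rewrite lee_fin.
- by apply/measurable_EFinP; exact: measurableT_comp.
by rewrite big_cons fineK// [LHS]muleC muleA.
Qed.

Lemma integral_prod_indep (f : nat -> R -> R) (J : seq nat) :
  (forall i, measurable_fun setT (f i)) -> (forall i x, 0 <= f i x)%R ->
  (forall i, \int[P]_w (f i (Xs i w))%:E < +oo) -> uniq J ->
  \int[P]_w (\prod_(i <- J) f i (Xs i w))%:E =
  \prod_(i <- J) \int[P]_w (f i (Xs i w))%:E.
Proof.
move=> mf f0 foo uJ.
have := @integral_prod_setI_indep f J [::] (fun=> setT) mf f0 foo.
rewrite bigcap_seq cats0 !big_nil mule1 => <-//.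
Qed.

End independence.

(** * Chernoff and Massart tail bounds for samples in the unit interval *)

Lemma expR_mul_le_affine (R : realType) (t x : R) : 0 <= x <= 1 ->
  expR (t * x) <= 1 + x * (expR t - 1).
Proof.
move=> /andP[x0 x1].
(* The tangent at [t * x], used at 0 and [t] with weights 1 - x and x, for which the slope terms
   cancel. *)
have tangent a : expR (t * x) * (1 + (a - t * x)) <= expR a.
  rewrite -[X in _ <= expR X](subrKC (t * x)) expRD ler_wpM2l ?expR_ge0//.
  exact: expR_ge1Dx.
have := tangent t; have := tangent 0; rewrite expR0 => h0 ht.
have x1' : 0 <= 1 - x by lra.
have := ler_wpM2l x0 ht; have := ler_wpM2l x1' h0; lra.
Qed.

Section iid_unit_samples.
Local Open Scope ereal_scope.
Context d (T : measurableType d) (R : realType) (P : probability T R).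

Lemma ge0_integral_same_law (Y X : {RV P >-> R}) (f : R -> \bar R) :
  same_law Y X -> measurable_fun setT f -> (forall x, 0 <= f x) ->
  \int[P]_w f (Y w) = \int[P]_w f (X w).
Proof.
move=> YX mf f0.
transitivity (\int[distribution P Y]_x f x).
  by rewrite ge0_integral_distribution.
transitivity (\int[distribution P X]_x f x).
  by apply: eq_measure_integral => A mA _; exact: YX.
by rewrite ge0_integral_distribution.
Qed.

Variables (X : {RV P >-> R}) (Xs : nat -> {RV P >-> R}) (mu : R).
Hypothesis X_unit : forall w, (0 <= X w <= 1)%R.
Hypothesis EX : 'E_P[X] = mu%:E.
Hypothesis mu_unit : (0 < mu < 1)%R.
Hypothesis Xs_iid : iid_samples X Xs.

Let measurable_expR_affine (t z : R) :
  measurable_fun setT (fun x : R => expR (t * (x - z)))%R.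
Proof.
apply: measurableT_comp => //; apply: measurable_funM => //.
exact: measurable_funB.
Qed.

(** The integral is moved to [X], which is bounded everywhere; there the exponential lies below its
    chord, so a Bernoulli variable is the worst case. *)
Lemma integral_expR_sample_le i (t z : R) :
  \int[P]_w (expR (t * (Xs i w - z)))%:E <=
  (expR (- (t * z)) * (1 + mu * (expR t - 1)))%:E.
Proof.
have mE : measurable_fun setT (EFin \o (fun x : R => expR (t * (x - z)))%R).
  by apply/measurable_EFinP.
rewrite (ge0_integral_same_law (Xs_iid.2 i) mE); last first.
  by move=> x; rewrite lee_fin expR_ge0.
have mX : measurable_fun setT (EFin \o X) by apply/measurable_EFinP.
have mCX : measurable_fun setT (EFin \o (fun w => 1 - X w)%R).
  by apply/measurable_EFinP; exact: measurable_funB.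
have X0 w : (0 <= X w)%R by case/andP: (X_unit w).
have CX0 w : (0 <= 1 - X w)%R by rewrite subr_ge0; case/andP: (X_unit w).
have iX : \int[P]_w (X w)%:E = mu%:E by rewrite -EX unlock.
have iCX : \int[P]_w (1 - X w)%:E = (1 - mu)%:E.
  have : \int[P]_w (1 - X w)%:E + \int[P]_w (X w)%:E = 1.
    rewrite -ge0_integralD//; last 2 first.
    - by move=> w _; rewrite lee_fin.
    - by move=> w _; rewrite lee_fin.
    under eq_integral do rewrite -EFinD subrK.
    by rewrite integral_cst// mul1e; exact: probability_setT.
  by rewrite iX EFinB => <-; rewrite addeK.
(* The chord is split as e^t X + (1 - X), so that every integrand is nonnegative. *)
apply: (@le_trans _ _ (\int[P]_w ((expR (- (t * z)))%:E *
    ((expR t)%:E * (X w)%:E + (1 - X w)%:E)))).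
  apply: ge0_le_integral => //.
  - by move=> w _; rewrite lee_fin expR_ge0.
  - exact: measurableT_comp.
  - apply: measurable_funeM; apply: emeasurable_funD => //.
    exact: measurable_funeM.
  - move=> w _; rewrite -[leRHS]/(expR (- (t * z)) *
      (expR t * X w + (1 - X w)))%:E lee_fin.
    rewrite mulrBr addrC expRD ler_wpM2l ?expR_ge0//.
    by have := expR_mul_le_affine t (X_unit w); lra.
rewrite ge0_integralZl_EFin ?expR_ge0//; last 2 first.
- by move=> w _; rewrite adde_ge0 ?mule_ge0 ?lee_fin ?expR_ge0.
- by apply: emeasurable_funD => //; exact: measurable_funeM.
rewrite ge0_integralD//; last 3 first.
- by move=> w _; rewrite mule_ge0 ?lee_fin ?expR_ge0.
- exact: measurable_funeM.
- by move=> w _; rewrite lee_fin.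
rewrite ge0_integralZl_EFin ?expR_ge0//; last by move=> w _; rewrite lee_fin.
by rewrite iX iCX -!(EFinM, EFinD) lee_fin; lra.
Qed.

Let S m w : R := (\sum_(i < m) Xs i w)%R.

Lemma measurable_sample_sum m : measurable_fun setT (S m).
Proof. by apply: measurable_sum => i. Qed.

Lemma measurable_sum_ge m (a : R) : measurable [set w | (a <= S m w)%R].
Proof.
rewrite -[X in measurable X]setTI.
have := measurable_sample_sum m measurableT (measurable_itv `[a, +oo[).
by congr (measurable (_ `&` _)); apply/seteqP; split => w /=;
  rewrite in_itv/= andbT.
Qed.

Lemma measurable_deviation m (c a : R) :
  measurable [set w | (0 <= c * (S m w - a))%R].
Proof.
rewrite -[X in measurable X]setTI.
have mf : measurable_fun setT (fun w => c * (S m w - a))%R.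
  apply: measurable_funM => //; apply: measurable_funB => //.
  exact: measurable_sample_sum.
have := mf measurableT _ (measurable_itv `[0%R, +oo[).
by congr (measurable (_ `&` _)); apply/seteqP; split => w /=;
  rewrite in_itv/= andbT.
Qed.

Lemma chernoff_sum m (t z : R) :
  P [set w | (0 <= t * (S m w - m%:R * z))%R] <=
  ((expR (- (t * z)) * (1 + mu * (expR t - 1))) ^+ m)%:E.
Proof.
set A := [set w | _].
have mA : measurable A by exact: measurable_deviation.
pose f (i : nat) (x : R) : R := expR (t * (x - z)).
have mf i : measurable_fun setT (f i) by exact: measurable_expR_affine.
have mprod : measurable_fun setT
    (fun w => \prod_(i <- index_iota 0 m) f i (Xs i w))%R.
  by apply: measurable_prod => i _; exact: measurableT_comp.
have f0 i x : (0 <= f i x)%R by rewrite expR_ge0.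
have intf i : \int[P]_w (f i (Xs i w))%:E <=
    (expR (- (t * z)) * (1 + mu * (expR t - 1)))%:E.
  exact: integral_expR_sample_le.
apply: (@le_trans _ _
    (\int[P]_w (\prod_(i <- index_iota 0 m) f i (Xs i w))%:E)).
  rewrite -[X in P X]setIT -integral_indic//; apply: ge0_le_integral => //.
  - by apply/measurable_EFinP.
  - by apply/measurable_EFinP.
  (* Markov's inequality: on [A] the product is the exponential of a nonnegative number, hence at
     least 1. *)
  - move=> w _; rewrite lee_fin indicE; have [|_] := boolP (w \in A).
      rewrite inE /A/= => Aw.
      rewrite big_mkord -expR_sum -mulr_sumr sumrB sumr_const card_ord.
      by rewrite -(mulr_natl z) -[leLHS]expR0 ler_expR.
    by rewrite prodr_ge0.
rewrite (integral_prod_indep Xs_iid.1)//; last 2 first.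
- by move=> i; rewrite (le_lt_trans (intf i))// ltry.
- exact: iota_uniq.
rewrite -[X in (_ ^+ X)%R](subn0 m) -prodr_const_nat -prodEFin.
elim: (index_iota 0 m) => [|i J IH]; first by rewrite !big_nil.
rewrite !big_cons; apply: lee_pmul => //.
- by rewrite integral_ge0// => w _; rewrite lee_fin.
- by rewrite prode_ge0// => k _; rewrite integral_ge0// => w _; rewrite lee_fin.
Qed.

(** The factor [z - mu] selects the upper tail when mu < z and the lower one when z < mu. *)
Lemma massart_tail m (z : R) : (0 < z <= 1)%R ->
  P [set w | (0 <= (z - mu) * (S m w - m%:R * z))%R] <=
  (expR (- (m%:R * massart_exponent z mu)))%:E.
Proof.
move=> z01.
have [zmu|zmu] := eqVneq z mu.
  rewrite /massart_exponent zmu subrr expr0n/= mul0r mulr0 oppr0 expR0.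
  by rewrite probability_le1//; exact: measurable_deviation.
have [t t0 tle] := chernoff_massart z01 mu_unit.
apply: (@le_trans _ _
    ((expR (- (t * z)) * (1 + mu * (expR t - 1))) ^+ m)%:E).
  apply: le_trans (chernoff_sum m t z); apply: le_measure; rewrite ?inE.
  1,2: exact: measurable_deviation.
  (* [t] has the sign of [z - mu] or is 0: (z - mu)^2 t (S - mz) is the product of the nonnegative
     quantities in [t0] and [h]. *)
  move=> w /= h; rewrite -(pmulr_rge0 _ (_ : 0 < (z - mu) ^+ 2)%R); last first.
    by rewrite exprn_even_gt0//= subr_eq0.
  by have := mulr_ge0 t0 h; lra.
rewrite lee_fin -(mulrN m%:R) expRM_natl lerXn2r ?nnegrE ?expR_ge0//.
rewrite mulr_ge0 ?expR_ge0//; have := expR_ge0 t; move: mu_unit; nra.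
Qed.

(** * Events containing the failures of each limit *)

Variables gamma delta : R.
Hypothesis gamma_gt0 : (0 < gamma)%R.
Hypothesis delta_unit : (0 < delta < 1)%R.

Let expRN_ln_delta (e : R) :
  (ln (2 / delta) <= e)%R -> (expR (- e) <= delta / 2)%R.
Proof.
move=> le_e; have /andP[d0 _] := delta_unit.
rewrite -[leRHS]lnK ?posrE ?divr_gt0// ler_expR -invf_div lnV ?lerN2//.
by rewrite posrE divr_gt0.
Qed.

Lemma lower_limit_miss : exists U : set T,
  [/\ measurable U, P U <= (delta / 2)%:E &
    forall w n, (forall i, 0 <= Xs i w <= 1)%R -> (gamma <= S n w)%R ->
      (mu <= lower_limit gamma delta n)%R -> U w].
Proof.
have /andP[mu0 _] := mu_unit.
pose fails := [pred n : nat |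
  (gamma <= n%:R)%R && (mu <= lower_limit gamma delta n)%R].
have fails_ge w n : (forall i, 0 <= Xs i w <= 1)%R -> (gamma <= S n w)%R ->
    (mu <= lower_limit gamma delta n)%R -> fails n.
  move=> Xw gS mun; rewrite /fails/= mun andbT (le_trans gS)//.
  rewrite -[X in (_ <= X%:R)%R](card_ord n) -sumr_const ler_sum// => i _.
  by case/andP: (Xw i).
have [exf|nof] := pselect (exists n, fails n); last first.
  exists set0; split; rewrite ?measure0 ?lee_fin//.
    by case/andP: delta_unit => ? _; rewrite divr_ge0 ?ltW.
  by move=> w n Xw gS mun; apply: nof; exists n; exact: fails_ge mun.
(* A failure forces mu <= gamma / n, that is n <= gamma / mu, so a largest failing size exists. *)
have ubf n : fails n -> (n <= Num.bound (gamma / mu))%N.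
  move=> /andP[gn mun].
  have [] := lower_limit_ge gamma_gt0 delta_unit mu_unit gn mun.
  rewrite ler_pdivlMr ?(lt_le_trans gamma_gt0)// mulrC -ler_pdivlMr// => nle _.
  rewrite ltnW// -(ltr_nat R) (le_lt_trans nle)// archi_boundP//.
  by rewrite divr_ge0// ltW.
case: (ex_maxnP exf ubf) => m /andP[gm mum] m_max.
have m0 : (0 < m%:R :> R)%R by exact: lt_le_trans gm.
have [muz le_m] := lower_limit_ge gamma_gt0 delta_unit mu_unit gm mum.
exists [set w | (gamma <= S m w)%R]; split.
- exact: measurable_sum_ge.
- apply: le_trans (_ : (expR (- (m%:R * massart_exponent (gamma / m%:R) mu)))%:E
      <= _); last by rewrite lee_fin expRN_ln_delta.
  apply: le_trans (massart_tail m _); last first.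
    by rewrite divr_gt0//= ler_pdivrMr// mul1r.
  apply: le_measure; rewrite ?inE; first exact: measurable_sum_ge.
    exact: measurable_deviation.
  move=> w /= h; rewrite mulr_ge0 ?subr_ge0// mulrC divfK// gt_eqF//.
(* Samples are nonnegative, so the sum is still at least [gamma] at m >= n. *)
- move=> w n Xw gS mun /=.
  have nm := m_max _ (fails_ge _ _ Xw gS mun); apply: le_trans gS _.
  rewrite /S -(big_mkord xpredT (Xs ^~ w)) -(big_mkord xpredT (Xs ^~ w)).
  rewrite (big_cat_nat _ nm)//= lerDl sumr_ge0// => i _.
  by case/andP: (Xw i).
Qed.

Lemma upper_limit_miss : exists V : set T,
  [/\ measurable V, P V <= (delta / 2)%:E &
    forall w n, is_sample_size gamma (Xs ^~ w) n ->
      (upper_limit gamma delta n <= mu)%R -> V w].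
Proof.
have /andP[mu0 mu1] := mu_unit.
pose fails := [pred n : nat | (upper_limit gamma delta n <= mu)%R].
have [exf|nof] := pselect (exists n, fails n); last first.
  exists set0; split; rewrite ?measure0 ?lee_fin//.
    by case/andP: delta_unit => ? _; rewrite divr_ge0 ?ltW.
  by move=> w n _ mun; apply: nof; exists n.
have large n : fails n -> (gamma + 1 < n%:R)%R.
  by rewrite /fails/= /upper_limit; case: ifP => // _; rewrite leNgt mu1.
(* The smallest failing size is positive and written [m.+1], so that the n - 1 of the limit becomes
   [m]. *)
case: (ex_minnP exf) => -[/large|m mum m_min].
  by rewrite ltNge addr_ge0// ltW.
have gm := large _ mum.
have [] := upper_limit_le gamma_gt0 delta_unit mu_unit gm mum.
rewrite -natr1 addrK => zmu le_m.
have {}gm : (gamma < m%:R)%R by rewrite -natr1 ltrD2r in gm.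
have m0 : (0 < m%:R :> R)%R by exact: lt_trans gm.
exists (~` [set w | (gamma <= S m w)%R]); split.
- exact/measurableC/measurable_sum_ge.
- apply: le_trans (_ : (expR (- (m%:R * massart_exponent (gamma / m%:R) mu)))%:E
      <= _); last by rewrite lee_fin expRN_ln_delta.
  apply: le_trans (massart_tail m _); last first.
    by rewrite divr_gt0//= ler_pdivrMr// mul1r ltW.
  apply: le_measure; rewrite ?inE; first exact/measurableC/measurable_sum_ge.
    exact: measurable_deviation.
  move=> w /= /negP; rewrite -ltNge => h.
  rewrite mulr_le0 ?subr_le0// mulrC divfK ?gt_eqF// ltW//.
(* If the sum had reached [gamma] at [m], then n <= m, against m.+1 <= n. *)
- move=> w n [n0 _ n_min] mun /= gS.
  have := n_min m _ gS; rewrite -(ltr_nat R) => /(_ m0).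
  by rewrite leqNgt (leq_trans _ (m_min _ mun)).
Qed.

Lemma measurable_is_sample_size n :
  measurable [set w | is_sample_size gamma (Xs ^~ w) n].
Proof.
have [n0|n0] := boolP (0 < n)%N; last first.
  rewrite (_ : [set w | _] = set0)//; apply/seteqP; split => // w -[n0'].
  by rewrite n0' in n0.
rewrite (_ : [set w | _] = [set w | (gamma <= S n w)%R] `&`
    \bigcap_(m in [set m | (0 < m < n)%N]) ~` [set w | (gamma <= S m w)%R]).
  apply: measurableI; first exact: measurable_sum_ge.
  by apply: bigcap_measurableType => m _; exact/measurableC/measurable_sum_ge.
apply/seteqP; split => w /=.
  move=> [_ gS n_min]; split=> // m /= /andP[m0 mn] gSm.
  by have := n_min m m0 gSm; rewrite leqNgt mn.
move=> [gS n_min]; split=> // m m0 gSm; rewrite leqNgt; apply/negP => mn.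
by apply: (n_min m) => //=; rewrite m0.
Qed.

(** Only [X] lies in the unit interval at every outcome; the samples inherit this almost surely
    through their law. *)
Lemma samples_outside_unit0 :
  P.-negligible (\bigcup_i (Xs i @^-1` ~` `[0%R, 1%R])).
Proof.
apply: negligible_bigcup => i; have mC : measurable (~` `[0%R, 1%R] : set R).
  by apply: measurableC; exact: measurable_itv.
apply/negligibleP; first exact: measurable_funPTI.
apply: (etrans (Xs_iid.2 i _ mC)); rewrite /distribution /pushforward.
rewrite (_ : _ @^-1` _ = set0) ?measure0//; apply/seteqP; split=> // w /=.
by rewrite in_itv/= X_unit.
Qed.

End iid_unit_samples.

(** * Coverage of the confidence interval *)

Lemma sample_sizeP (R : realType) (gamma : R) (x : nat -> R) n :
  (0 < n)%N -> sample_size gamma x = n <-> is_sample_size gamma x n.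
Proof.
move=> n0; split=> [nE|xn].
  move: nE; rewrite /sample_size; case: xgetP => [_ -> xm <-//|_ nE].
  by rewrite -nE in n0.
rewrite /sample_size; case: xgetP => [m _ [m0 xm mle]|/(_ n)//].
case: xn => _ xn nle; apply/eqP; rewrite eqn_leq mle// nle//.
Qed.
(* Covers the outcomes whose sums stay below gamma, where sample_size takes its
   default value 0. *)
Lemma limits_cover_at_0 (R : realType) (gamma delta mu : R) :
  0 < gamma -> 0 < delta < 1 -> 0 < mu < 1 ->
  lower_limit gamma delta 0 < mu < upper_limit gamma delta 0.
Proof.
move=> g0 d01 /andP[mu0 mu1]; apply/andP; split; last first.
  by rewrite /upper_limit ifF//; apply/negbTE; rewrite -leNgt addr_ge0// ltW.
apply: le_lt_trans mu0; rewrite /lower_limit invr0 !mulr0 mul0r add0r.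
rewrite !subr0 mulr1 addr0 pmulr_rle0 ?divr_gt0// subr_le0.
have tg0 : 0 <= theta delta * gamma by rewrite mulr_ge0 ?ltW ?theta_gt0.
by rewrite -[leLHS]sqrtr1 ler_wsqrtr// lerDl.
Qed.

Theorem theorem3 (d : measure_display) (T : measurableType d) (R : realType)
    (P : probability T R) (X : {RV P >-> R}) (Xs : nat -> {RV P >-> R})
    (mu gamma delta : R)
    (X_unit : forall w : T, 0 <= X w <= 1)
    (EX : ('E_P[X])%E = mu%:E)
    (mu_unit : 0 < mu < 1)
    (Xs_iid : iid_samples X Xs)
    (gamma_gt0 : 0 < gamma)
    (delta_unit : 0 < delta < 1) :
  let n (w : T) : nat := sample_size gamma (fun i : nat => Xs i w) in
  ((1 - delta)%:E <=
    P [set w : T | (lower_limit gamma delta (n w) < mu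
                    < upper_limit gamma delta (n w))%R])%E.
Proof.
cbv zeta; pose n w := sample_size gamma (Xs ^~ w).
set good := [set w | _].
pose fails := [set k | ~ (lower_limit gamma delta k < mu <
                          upper_limit gamma delta k)].
(* The default size 0 is never a failure, so failures split by genuine sample sizes into countably
   many measurable events. *)
have goodC : ~` good =
    \bigcup_(k in fails) [set w | is_sample_size gamma (Xs ^~ w) k].
  apply/seteqP; split=> [w bad_w|w [k fails_k wk] good_w].
    exists (n w) => //=; apply/sample_sizeP => //; rewrite lt0n.
    apply/eqP => n0; apply: bad_w; rewrite /good/= -/(n w) n0.
    exact: limits_cover_at_0.
  have /sample_sizeP nk := wk; apply: fails_k; rewrite -nk//.
  by case: wk.
have mgoodC : measurable (~` good).
  rewrite goodC; apply: bigcup_measurable => k _.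
  exact: measurable_is_sample_size.
have [U [mU PU lowerU]] := lower_limit_miss X_unit EX mu_unit Xs_iid
  gamma_gt0 delta_unit.
have [V [mV PV upperV]] := upper_limit_miss X_unit EX mu_unit Xs_iid
  gamma_gt0 delta_unit.
have [N [mN PN0 outN]] := samples_outside_unit0 X_unit Xs_iid.
rewrite -[good]setCK probability_setC//.
rewrite EFinB leeB// -[leRHS]/(delta%:E).
(* The error budget: 0 for samples outside the unit interval, [delta / 2] for each limit. *)
rewrite [leRHS](_ : _ = 0 + ((delta / 2)%:E + (delta / 2)%:E))%E; last first.
  by rewrite add0e -EFinD -splitr.
apply: (@le_trans _ _ (P (N `|` (U `|` V)))).
  apply: le_measure; rewrite ?inE//; first by do 2 apply: measurableU => //.
  rewrite goodC => w [k fails_k wk].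
  have [Nw|Nw] := pselect (N w); [by left|right].
  have Xw i : 0 <= Xs i w <= 1.
    by apply: contrapT => Xiw; apply: Nw; apply: outN; exists i.
  have [low|low] := ltP (lower_limit gamma delta k) mu; last first.
    by left; apply: lowerU low => //; case: wk.
  right; apply: (upperV _ _ wk).
  by rewrite leNgt; apply/negP => up; apply: fails_k; rewrite low.
apply: (le_trans (measureU2 _ _ _)) => //; first exact: measurableU.
apply: leeD; first by rewrite le_eqVlt; apply/orP; left; apply/eqP.
apply: (le_trans (measureU2 _ _ _)) => //.
exact: leeD.
Qed.
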